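(* Let $F$ be a field of characteristic different from two. Suppose $K$ is a separable quadratic extension of $F$ of the form $K=F(\sqrt{c})$, for some $c\in F^\times\smallsetminus(F^\times)^2$, and let $\sigma\in\mathrm{Gal}(K/F)$ be nontrivial. Let $\mathcal{C}_K\subset F^\times$ denote a set of coset representatives of $F^\times/N_{K/F}(K^\times)$. Then the distinct isomorphism classes of the nonassociative quaternion algebras with left nucleus $K$ are represented (each exactly once) by $(K/F,\sigma,a)$ where $a$ is chosen from the set $\mathcal{S}(K)$ given as follows. If $-1\in N_{K/F}(K^\times)$, $$\mathcal{S}(K)=\{r\sqrt{c},\ r+s\sqrt{c}\mid r\in\mathcal{C}_K,\ s\in F^\times/\{\pm1\}\}.$$ If $-1\notin N_{K/F}(K^\times)$, $$\mathcal{S}(K)=\{r'\sqrt{c}\mid r'\in\mathcal{C}_K/\{\pm1\}\}\cup\{r+s\sqrt{c}\mid r\in\mathcal{C}_K,\ s\in F^\times/\{\pm1\}\}.$$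
   Context: For a quadratic Galois extension $K/F$ with nontrivial automorphism $\sigma$ and $a\in K\smallsetminus F$, the (proper) nonassociative quaternion algebra $(K/F,\sigma,a)$ is the unital $4$-dimensional $F$-algebra $K\oplus Kt$ with $F$-bilinear multiplication determined by $(k)(k')=kk'$, $(k)(k't)=kk't$, $(kt)(k')=k\sigma(k')t$, $(kt)(k't)=k\sigma(k')a$ for $k,k'\in K$. The left nucleus of an algebra $A$ is $\{x\in A: (xy)z=x(yz)\ \forall y,z\in A\}$; for $(K/F,\sigma,a)$ with $a\in K\smallsetminus F$ it equals $K$. Isomorphism means isomorphism of $F$-algebras. $N_{K/F}$ is the field norm. $F^\times/\{\pm1\}$ stands for a set of representatives in $F^\times$ of the cosets of $\{\pm1\}$. When $-1\notin N_{K/F}(K^\times)$, the group $F^\times/N_{K/F}(K^\times)$ contains the order-two subgroup generated by the class of $-1$, and $\mathcal{C}_K/\{\pm1\}$ denotes a set of representatives in $F^\times$ of the quotient of $F^\times/N_{K/F}(K^\times)$ by this subgroup. *)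

(* Defs.v *)
From HB Require Import structures.
From mathcomp Require Import all_boot all_algebra all_fingroup all_field.
From mathcomp Require Import classical_sets.

Set Implicit Arguments.
Unset Strict Implicit.
Unset Printing Implicit Defensive.

Import GRing.Theory.
Local Open Scope ring_scope.
Local Open Scope classical_set_scope.

(* Not necessarily associative, unital algebras over F. *)
Record naAlg (F : fieldType) := NAAlg {
  na_car :> lmodType F;
  na_mul : na_car -> na_car -> na_car;
  na_one : na_car;
  na_mul_linearr : forall x, linear (na_mul x);
  na_mul_linearl : forall y, linear (na_mul^~ y);
  na_mul1x : left_id na_one na_mul;
  na_mulx1 : right_id na_one na_mul
}.

Definition na_iso (F : fieldType) (A B : naAlg F) : Prop :=
  exists f : {linear A -> B},
    [/\ bijective f, f (na_one A) = na_one B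
      & forall x y, f (na_mul x y) = na_mul (f x) (f y)].

Definition left_nucleus (F : fieldType) (A : naAlg F) : set A :=
  [set x | forall y z, na_mul (na_mul x y) z = na_mul x (na_mul y z)].
Arguments left_nucleus {F} A.

(* The left nucleus of A is K, up to isomorphism of F-algebras: it is the
   image of an injective homomorphism of F-algebras K -> A. *)
Definition has_left_nucleus (F : fieldType) (K : fieldExtType F)
    (A : naAlg F) : Prop :=
  exists f : {linear K -> A},
    [/\ injective f, f 1 = na_one A,
        forall x y, f (x * y) = na_mul (f x) (f y)
      & range f = left_nucleus A].

Section NonassociativeQuaternion.

Variables (F : fieldType) (K : splittingFieldType F).
Variables (sigma : gal_of {:K}) (a : K).

(* The pair (k, l) stands for k + l t. *)
Definition naquat_mul (x y : K * K) : K * K :=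
  (x.1 * y.1 + x.2 * sigma y.2 * a, x.1 * y.2 + x.2 * sigma y.1).

Lemma naquat_mul_linearr x : linear (naquat_mul x).
Proof.
move=> k y z; rewrite /naquat_mul /= !linearP /=; congr (_, _) => /=.
  by rewrite !mulrDr !mulrDl -!scalerAr -!scalerAl addrACA -scalerDr.
by rewrite !mulrDr -!scalerAr addrACA -scalerDr.
Qed.

Lemma naquat_mul_linearl y : linear (naquat_mul^~ y).
Proof.
move=> k x z; rewrite /naquat_mul /=.
by congr (_, _) => /=; rewrite !mulrDl -!scalerAl addrACA -scalerDr.
Qed.

Lemma naquat_mul1x : left_id (1, 0) naquat_mul.
Proof. by case=> k l; rewrite /naquat_mul /= !mul0r !mul1r !addr0. Qed.

Lemma naquat_mulx1 : right_id (1, 0) naquat_mul.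
Proof.
by case=> k l; rewrite /naquat_mul /= rmorph0 rmorph1 !mulr0 !mulr1 mul0r addr0 add0r.
Qed.

Definition naquat : naAlg F :=
  @NAAlg F (K * K)%type naquat_mul (1, 0)
    naquat_mul_linearr naquat_mul_linearl naquat_mul1x naquat_mulx1.

End NonassociativeQuaternion.

(* A is a proper nonassociative quaternion algebra over F, for some quadratic
   Galois extension L of F. *)
Definition is_naquat (F : fieldType) (A : naAlg F) : Prop :=
  exists (L : splittingFieldType F) (tau : gal_of {:L}) (b : L),
    [/\ \dim {:L} = 2%N /\ galois 1 {:L},
        tau \in 'Gal({:L} / 1)%g, tau != 1%g, b \notin 1%VS
      & na_iso A (naquat tau b)].

(* T is a set of representatives of the cosets in F^* of its subgroup H. *)
Definition coset_reps (F : fieldType) (H T : set F) : Prop :=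
  (forall t, T t -> t != 0) /\
  (forall x, x != 0 -> exists! t, T t /\ H (x / t)).

Definition pm1 (F : fieldType) : set F := [set x | x = 1 \/ x = -1].
Arguments pm1 F : clear implicits.

Definition norms (F : fieldType) (K : splittingFieldType F) : set F :=
  [set r | exists2 x : K, x != 0 & galNorm 1 {:K} x = r%:A].

(* The preimage in F^* of the subgroup of F^* / N(K^* ) generated by the class
   of -1. *)
Definition norms_pm1 (F : fieldType) (K : splittingFieldType F) : set F :=
  [set r | norms K r \/ norms K (- r)].

(* The set { r w | r in R } U { r + s w | r in C, s in P }. *)
Definition reps_set (F : fieldType) (K : fieldExtType F) (w : K)
    (R C P : set F) : set K :=
  [set r%:A * w | r in R] `|` [set r%:A + s%:A * w | r in C & s in P].

(* The algebras (K/F, sigma, a) with a in S are proper nonassociative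
   quaternion algebras with left nucleus K, and represent each isomorphism
   class of such algebras exactly once. *)
Definition classifies_naquat (F : fieldType) (K : splittingFieldType F)
    (sigma : gal_of {:K}) (S : set K) : Prop :=
  (forall a, S a -> [/\ a \notin 1%VS, is_naquat (naquat sigma a)
                      & has_left_nucleus K (naquat sigma a)]) /\
  (forall A : naAlg F, is_naquat A -> has_left_nucleus K A ->
     exists! a, S a /\ na_iso A (naquat sigma a)).

(* Main.v *)
Require Import Defs.
From HB Require Import structures.
From mathcomp Require Import all_boot all_algebra all_fingroup all_field.
From mathcomp Require Import classical_sets.

Set Implicit Arguments.
Unset Strict Implicit.
Unset Printing Implicit Defensive.

Import GRing.Theory.
Local Open Scope ring_scope.

(** Write N for the norm of K over F. Everything rests on one description of
    isomorphisms: (K/F, sigma, a) and (K/F, sigma, b) with a, b outside F are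
    isomorphic if and only if N(m) b is a or sigma a for some nonzero m in K.

    Since a is not fixed by sigma, the left nucleus of (K/F, sigma, a) is
    exactly K ([naquat_left_nucleusE]), so an isomorphism g restricts to an
    F-automorphism h of K ([alg_iso_of_left_nucleus]). The relation
    t k = sigma(k) t forces g(t) to be a multiple m t of t, and t t = a then
    gives h(a) = N(m) b ([naquat_iso_scalar]). Conversely such h and m define
    an isomorphism k + l t |-> h(k) + h(l) m t ([naquat_iso_of_alg_iso]). These
    arguments allow two different fields K and L, so they also show that every
    nonassociative quaternion algebra with left nucleus K, whatever quadratic
    extension it was built from, is some (K/F, sigma, a)
    ([naquat_with_left_nucleus]).

    In the coordinates a = x + y w with w the square root of c, sigma is
    y |-> - y and N takes values in F. So x + y w and x' + y' w give isomorphic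
    algebras if and only if x = n x' and y = n y' or - n y' for a norm n
    ([naquat_quadratic_isoP]). What remains is a computation with cosets in the
    multiplicative group of F ([reps_set_classifies]). If x = 0, only y modulo
    norms and signs matters. If x is not 0, normalizing x to its representative
    modulo norms determines n, and y / n is then determined up to sign. When -1
    is a norm, norms and signs generate the group of norms, so both cases of the
    theorem are instances of the same classification. *)

(** * Isomorphisms of nonassociative algebras *)

(** Lets the isomorphism be given by a bare function, so that inverses,
    composites and explicit formulas need no bundled linear structure. *)
Lemma na_isoP (F : fieldType) (A B : naAlg F) (f : A -> B) :
    linear f -> bijective f -> f (na_one A) = na_one B ->
    {morph f : x y / na_mul x y >-> na_mul x y} ->
  na_iso A B.
Proof.
move=> f_lin f_bij f1 fM.
pose fL := GRing.isLinear.Build F A B *:%R f f_lin.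
by exists (HB.pack_for {linear A -> B} f fL).
Qed.

Lemma na_iso_refl (F : fieldType) (A : naAlg F) : na_iso A A.
Proof. by apply: (@na_isoP F A A id) => //; exists id. Qed.

Lemma na_iso_sym (F : fieldType) (A B : naAlg F) : na_iso A B -> na_iso B A.
Proof.
case=> f [[g fK gK] f1 fM].
have f_inj : injective f := can_inj fK.
apply: (@na_isoP F B A g); first 1 last.
- by exists f.
- by rewrite -f1 fK.
- by move=> x y; apply: f_inj; rewrite fM !gK.
by move=> k x y; apply: f_inj; rewrite linearP !gK.
Qed.

Lemma na_iso_trans (F : fieldType) (A B C : naAlg F) :
  na_iso A B -> na_iso B C -> na_iso A C.
Proof.
case=> f [f_bij f1 fM] [g [g_bij g1 gM]].
apply: (@na_isoP F A C (g \o f)).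
- by move=> k x y; rewrite linearP.
- exact: bij_comp.
- by rewrite /= f1 g1.
by move=> x y /=; rewrite fM gM.
Qed.

Lemma left_nucleus_iso (F : fieldType) (A B : naAlg F) (f : {linear A -> B})
    (x : A) :
    bijective f -> {morph f : u v / na_mul u v >-> na_mul u v} ->
  left_nucleus B (f x) <-> left_nucleus A x.
Proof.
case=> g fK gK fM; split=> [xN y z | xN y z].
  by apply: (can_inj fK); rewrite !fM xN.
by rewrite -(gK y) -(gK z) -!fM xN.
Qed.

(** * The left nucleus of a nonassociative quaternion algebra *)

Lemma naquat_left_nucleusE (F : fieldType) (K : splittingFieldType F)
    (sigma : gal_of {:K}) (a : K) (x : naquat sigma a) :
  sigma a != a -> left_nucleus (naquat sigma a) x <-> x.2 = 0.
Proof.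
move=> sa; case: x => k l /=; split=> [xN | -> [y1 y2] [z1 z2]].
  (* ((l t) t) t = (l a) t, whereas (l t) (t t) = l (sigma a) t *)
  have /(congr1 snd) := xN (0, 1) (0, 1).
  rewrite /= /naquat_mul /= !rmorph1 !rmorph0 /=.
  rewrite ?(mulr0, mul0r, mulr1, mul1r, addr0, add0r).
  move/eqP; rewrite -subr_eq0 -mulrBr mulf_eq0 subr_eq0 => /orP[/eqP //|/eqP as_].
  by rewrite -as_ eqxx in sa.
by rewrite /= /naquat_mul /= !(mul0r, addr0) !mulrDr !mulrA.
Qed.

(** Besides showing that K is the left nucleus, records that the embedding
    is the obvious one, which is what identifies the images of elements of K
    under an isomorphism. *)
Lemma naquat_embedding (F : fieldType) (K : splittingFieldType F)
    (sigma : gal_of {:K}) (a : K) : sigma a != a ->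
  exists f : {linear K -> naquat sigma a},
    [/\ injective f, f 1 = na_one (naquat sigma a),
        {morph f : x y / x * y >-> na_mul x y},
        range f = left_nucleus (naquat sigma a)
      & forall k, f k = (k, 0)].
Proof.
move=> sa; pose f (k : K) : naquat sigma a := (k, 0).
have f_lin : linear f.
  by move=> k x y; congr (_, _); rewrite /= scaler0 addr0.
pose fL := GRing.isLinear.Build F K (naquat sigma a) *:%R f f_lin.
exists (HB.pack_for {linear K -> naquat sigma a} f fL); split=> //=.
- by move=> x y [].
- by move=> x y; rewrite /f /naquat_mul /= !(mul0r, mulr0, addr0).
apply/seteqP; split=> [_ [k _ <-] | [k l] /naquat_left_nucleusE].
  exact/naquat_left_nucleusE.
by move=> /(_ sa) /= ->; exists k.
Qed.

(** * Isomorphisms between nonassociative quaternion algebras *)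

(** With t' the generator of the target, the map is
    k + l t |-> h(k) + h(l) m t'. It is compatible with t k = sigma(k) t because
    h intertwines sigma and tau, and with t t = a because
    (m t') (m t') = m tau(m) b. *)
Lemma naquat_iso_of_alg_iso (F : fieldType) (K L : splittingFieldType F)
    (sigma : gal_of {:K}) (tau : gal_of {:L}) (a : K) (b m : L)
    (h : {linear K -> L}) :
    bijective h -> h 1 = 1 -> {morph h : x y / x * y} ->
    {morph h : x / sigma x >-> tau x} ->
    m != 0 -> h a = m * tau m * b ->
  na_iso (naquat sigma a) (naquat tau b).
Proof.
move=> [g hK gK] h1 hM hs m_neq0 ha.
apply: (@na_isoP F (naquat sigma a) (naquat tau b)
          (fun x => (h x.1, h x.2 * m))).
- by move=> k x y; congr (_, _); rewrite /= linearP //= mulrDl -scalerAl.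
- exists (fun x => (g x.1, g (x.2 / m))) => [[k l] | [k l]] /=.
    by rewrite mulfK // !hK.
  by rewrite !gK divfK.
- by rewrite /= h1 linear0 mul0r.
case=> k l [k' l'] /=; rewrite /naquat_mul /=; congr (_, _).
  rewrite linearD /= !hM hs ha rmorphM; congr (_ + _).
  by rewrite !mulrA -!(mulrAC _ (tau (h l'))).
by rewrite linearD /= !hM hs mulrDl mulrA (mulrAC _ m).
Qed.

(** An isomorphism matches left nuclei. Hence if a copy of K is the left
    nucleus of an algebra isomorphic to (L/F, tau, b), whose left nucleus is L,
    then the isomorphism identifies K with L. *)
Lemma alg_iso_of_left_nucleus (F : fieldType) (K L : splittingFieldType F)
    (tau : gal_of {:L}) (b : L) (A : naAlg F)
    (f : {linear K -> A}) (g : {linear A -> naquat tau b}) :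
    tau b != b ->
    injective f -> f 1 = na_one A ->
    {morph f : x y / x * y >-> na_mul x y} ->
    range f = left_nucleus A ->
    bijective g -> g (na_one A) = na_one (naquat tau b) ->
    {morph g : x y / na_mul x y >-> na_mul x y} ->
  exists h : {linear K -> L},
    [/\ bijective h, h 1 = 1, {morph h : x y / x * y}
      & forall k, g (f k) = (h k, 0)].
Proof.
move=> tb f_inj f1 fM f_range g_bij g1 gM.
pose h k := (g (f k)).1.
have gf2 k : (g (f k)).2 = 0.
  apply/(@naquat_left_nucleusE _ _ tau b) => //.
  by apply/(left_nucleus_iso _ g_bij gM); rewrite -f_range; exists k.
have gfE k : g (f k) = (h k, 0) by rewrite [LHS]surjective_pairing gf2.
have h_lin : linear h by move=> k x y; rewrite /h !linearP.
have h_surj l : exists k, h k == l.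
  have [g' gK g'K] := g_bij.
  have: left_nucleus A (g' (l, 0)).
    apply/(left_nucleus_iso _ g_bij gM); rewrite g'K.
    exact/naquat_left_nucleusE.
  by rewrite -f_range => -[k _ fk]; exists k; rewrite /h fk g'K.
have h_inj : injective h.
  move=> x y hxy; apply/f_inj/(bij_inj g_bij).
  by rewrite !gfE hxy.
pose hL := GRing.isLinear.Build F K L *:%R h h_lin.
exists (HB.pack_for {linear K -> L} h hL); split=> //=.
- have hgK : cancel (fun l => xchoose (h_surj l)) h.
    by move=> l; apply/eqP/(xchooseP (h_surj l)).
  by exists (fun l => xchoose (h_surj l)) => // k; apply: h_inj; rewrite hgK.
- by rewrite /h f1 g1.
by move=> x y; rewrite /h fM gM !gfE /= mul0r mul0r addr0.
Qed.

(** The image of t determines m. By comparing the two sides of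
    t a = sigma(a) t, the component of the image of t in L is killed by
    h(a) - h(sigma a), which is not zero; so t goes to a multiple m t' of the
    generator t' of the target, and squaring it gives h(a). *)
Lemma naquat_iso_scalar (F : fieldType) (K L : splittingFieldType F)
    (sigma : gal_of {:K}) (tau : gal_of {:L}) (a : K) (b : L) :
    sigma a != a -> tau b != b -> na_iso (naquat sigma a) (naquat tau b) ->
  exists2 h : {linear K -> L}, h 1 = 1 /\ {morph h : x y / x * y}
    & exists2 m, m != 0 & h a = m * tau m * b.
Proof.
move=> sa tb [g [g_bij g1 gM]].
have [f [f_inj f1 fM f_range fE]] := naquat_embedding sa.
have [h [h_bij h1 hM gfE]] :=
  alg_iso_of_left_nucleus tb f_inj f1 fM f_range g_bij g1 gM.
exists h => //.
have gE k : g (k, 0) = (h k, 0) by rewrite -fE gfE.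
pose t : naquat sigma a := (0, 1).
have [p [m gt]] : exists p m, g t = (p, m) by case: (g t) => p m; exists p, m.
(* otherwise t would be in the left nucleus *)
have m_neq0 : m != 0.
  apply/eqP => m0.
  have : left_nucleus (naquat tau b) (g t).
    by apply/naquat_left_nucleusE => //; rewrite gt.
  move/(left_nucleus_iso _ g_bij gM)/(naquat_left_nucleusE _ sa) => /= /eqP.
  by rewrite oner_eq0.
have p0 : p = 0.
  have tk : na_mul t (a, 0) = na_mul ((sigma a, 0) : naquat sigma a) t.
    rewrite /= /naquat_mul /= !rmorph0.
    by rewrite !(mul0r, mulr0, mul1r, mulr1, addr0, add0r).
  have /(congr1 fst) := congr1 g tk.
  rewrite !gM !gE gt /= /naquat_mul /= rmorph0 !(mul0r, mulr0, addr0).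
  rewrite mulrC => /eqP; rewrite -subr_eq0 -mulrBl mulf_eq0 subr_eq0.
  by case/orP=> /eqP // /(bij_inj h_bij) as_; rewrite -as_ eqxx in sa.
exists m => //.
have tt : na_mul t t = (a, 0).
  rewrite /= /naquat_mul /= !rmorph1 rmorph0.
  by rewrite !(mul0r, mulr0, mul1r, addr0, add0r).
have /(congr1 fst) := congr1 g tt.
by rewrite gM gE gt p0 /= /naquat_mul /= mul0r add0r.
Qed.

(** * Quadratic Galois extensions *)

Lemma gal_quadratic (F : fieldType) (K : splittingFieldType F)
    (sigma : gal_of {:K}) :
    \dim {:K} = 2%N -> galois 1 {:K} ->
    sigma \in 'Gal({:K} / 1)%g -> sigma != 1%g ->
  ('Gal({:K} / 1) = [set 1; sigma])%g.
Proof.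
move=> dimK galK sG s1; apply/esym/eqP.
rewrite eqEcard cards2 eq_sym s1 -(galois_dim galK) dimv1 dimK divn1 leqnn andbT.
by apply/fintype.subsetP=> x /set2P[] ->.
Qed.

Lemma gal_quadratic_fixed (F : fieldType) (K : splittingFieldType F)
    (sigma : gal_of {:K}) (a : K) :
    \dim {:K} = 2%N -> galois 1 {:K} ->
    sigma \in 'Gal({:K} / 1)%g -> sigma != 1%g ->
  (sigma a == a) = (a \in 1%VS).
Proof.
move=> dimK galK sG s1; apply/eqP/idP => [sa | /(fixed_gal (sub1v _) sG) //].
suff: a \in fixedField 'Gal({:K} / 1)%g by rewrite (elimT galois_fixedField galK).
apply/fixedFieldP; rewrite ?memvf // => x.
by rewrite (gal_quadratic dimK galK sG s1) => /set2P[] -> //; rewrite gal_id.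
Qed.

Section QuadraticExtension.

Variables (F : fieldType) (K : splittingFieldType F).
Hypotheses (galK : galois 1 {:K}) (dimK : \dim {:K} = 2%N).
Variables (c : F) (w : K).
Hypotheses (c_nsq : forall x : F, x ^+ 2 != c) (w_sq : w ^+ 2 = c%:A).
Variable sigma : gal_of {:K}.
Hypotheses (sigma_gal : sigma \in 'Gal({:K} / 1)%g) (sigma_neq1 : sigma != 1%g).

Let sigma_fixed a : (sigma a == a) = (a \in 1%VS).
Proof. exact: gal_quadratic_fixed. Qed.

Let sigma_alg x : sigma x%:A = x%:A.
Proof. by rewrite linearZ rmorph1. Qed.

Lemma sqrt_notin_base : w \notin 1%VS.
Proof.
apply/vlineP=> -[x wx]; have /eqP[] := c_nsq x.
by apply: (fmorph_inj (in_alg K)); rewrite rmorphXn /= -wx w_sq.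
Qed.

Lemma quadratic_coord v : exists x y, v = x%:A + y%:A * w.
Proof.
have adj2 : adjoin_degree 1%AS w = 2%N.
  apply/eqP; rewrite eqn_leq; apply/andP; split.
    rewrite -[adjoin_degree _ _]muln1 -[X in (_ * X)%N](dimv1 K) -dim_Fadjoin -dimK.
    exact/dimvS/subvf.
  have := adjoin_deg_eq1 1%AS w; rewrite (negPf sqrt_notin_base).
  have : (0 < adjoin_degree 1%AS w)%N by [].
  by case: (adjoin_degree _ _) => [//|[//|n]].
have adjT : <<1; w>>%VS = {:K}%VS.
  by apply/eqP; rewrite eqEdim subvf /= dim_Fadjoin adj2 dimv1 dimK.
have /Fadjoin_poly_eq <- : v \in <<1%AS; w>>%VS by rewrite adjT memvf.
set p := Fadjoin_poly _ _ _.
have sp : (size p <= 2)%N by rewrite -adj2 size_Fadjoin_poly.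
have /polyOverP pF : p \is a polyOver 1%VS by exact: Fadjoin_polyOver.
have /vlineP[x px] := pF 0%N; have /vlineP[y py] := pF 1%N.
exists x, y; rewrite (horner_coef_wide _ sp) big_ord_recl big_ord1 /=.
by rewrite px py expr0 expr1 mulr1.
Qed.

(** Together with [quadratic_coord] this makes 1, w a basis of K over F. *)
Lemma quadratic_coord_notin x y :
  (x%:A + y%:A * w \notin 1%VS) = (y != 0).
Proof.
have alg1 (z : F) : (z%:A : K) \in 1%VS by apply/vlineP; exists z.
rewrite rpredDl //; have [-> | y_neq0] := eqVneq y 0.
  by rewrite scale0r mul0r mem0v.
by rewrite -scalerAl mul1r rpredZeq negb_or y_neq0 sqrt_notin_base.
Qed.

Lemma quadratic_coord_inj x y x' y' :
  x%:A + y%:A * w = x'%:A + y'%:A * w -> x = x' /\ y = y'.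
Proof.
move=> /eqP; rewrite -subr_eq0 opprD addrACA -mulrBl -!scalerBl => /eqP eq0.
have /negbFE/eqP yy' : (y - y' != 0) = false.
  by rewrite -(quadratic_coord_notin (x - x')) eq0 mem0v.
move: eq0; rewrite yy' scale0r mul0r addr0 => /eqP.
rewrite scaler_eq0 oner_eq0 orbF subr_eq0 => /eqP ->.
by move/eqP: yy'; rewrite subr_eq0 => /eqP ->.
Qed.

Lemma sigma_sqrt : sigma w = - w.
Proof.
have : sigma w ^+ 2 == w ^+ 2 by rewrite -rmorphXn /= w_sq sigma_alg.
rewrite eqf_sqr sigma_fixed (negPf sqrt_notin_base).
by move/eqP.
Qed.

Lemma norm_quadratic v : galNorm 1 {:K} v = v * sigma v.
Proof.
rewrite /galNorm (gal_quadratic dimK galK sigma_gal sigma_neq1).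
by rewrite big_setU1 ?inE 1?eq_sym //= big_set1 gal_id.
Qed.

Lemma normsP n :
  norms K n <-> exists2 m : K, m != 0 & m * sigma m = n%:A.
Proof. by split=> -[m m0 mn]; exists m; rewrite ?norm_quadratic // -norm_quadratic. Qed.

Lemma norm_in_base m : exists n, m * sigma m = n%:A.
Proof.
have [x [y ->]] := quadratic_coord m.
rewrite rmorphD rmorphM /= !sigma_alg sigma_sqrt.
exists (x ^+ 2 - y ^+ 2 * c).
rewrite mulrN mulrC -subr_sqr exprMn w_sq !exprZn !expr1n.
by rewrite -scalerAl mul1r scalerA scalerBl.
Qed.

Lemma norms_neq0 n : norms K n -> n != 0.
Proof.
move=> /normsP[m m0 mn]; apply/eqP => n0.
by move/eqP: mn; rewrite n0 scale0r mulf_eq0 fmorph_eq0 (negPf m0).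
Qed.

Lemma normsM n n' : norms K n -> norms K n' -> norms K (n * n').
Proof.
move=> /normsP[m m0 mn] /normsP[m' m0' mn']; apply/normsP.
exists (m * m'); rewrite ?mulf_neq0 //.
by rewrite rmorphM mulrACA mn mn' -!in_algE -rmorphM.
Qed.

(** An F-endomorphism sends w to a square root of c, that is w or - w, and
    is determined by this choice. *)
Lemma alg_endo_quadratic (h : {linear K -> K}) :
  h 1 = 1 -> {morph h : x y / x * y} -> h =1 id \/ h =1 sigma.
Proof.
move=> h1 hM.
have halg x : h x%:A = x%:A by rewrite linearZ /= h1.
have : h w ^+ 2 == w ^+ 2 by rewrite expr2 -hM -expr2 w_sq halg.
rewrite eqf_sqr => /orP[] /eqP hw; [left|right] => v.
  have [x [y ->]] := quadratic_coord v.
  by rewrite linearD /= hM !halg hw.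
have [x [y ->]] := quadratic_coord v.
by rewrite linearD rmorphD rmorphM /= hM !halg hw !sigma_alg sigma_sqrt.
Qed.

(** * Classification in coordinates *)

(** The sign in y = - (n * y') is that of the automorphism induced on K:
    the identity or sigma. *)
Lemma naquat_quadratic_isoP x y x' y' : y != 0 -> y' != 0 ->
  na_iso (naquat sigma (x%:A + y%:A * w)) (naquat sigma (x'%:A + y'%:A * w)) <->
  exists n, [/\ norms K n, x = n * x' & y = n * y' \/ y = - (n * y')].
Proof.
move=> y0 y0'.
set a := _ + _; set b := _ + _.
have sa : sigma a != a by rewrite sigma_fixed quadratic_coord_notin.
have sb : sigma b != b by rewrite sigma_fixed quadratic_coord_notin.
have sigma_a : sigma a = x%:A + (- y)%:A * w.
  by rewrite rmorphD rmorphM /= !sigma_alg sigma_sqrt mulrN scaleNr mulNr.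
have scale_b n : n%:A * b = (n * x')%:A + (n * y')%:A * w.
  by rewrite mulrDr mulrA -!in_algE !rmorphM.
split=> [ab | [n [/normsP[m m0 mn] xE yE]]].
  have [h [h1 hM] [m m0 hab]] := naquat_iso_scalar sa sb ab.
  have [n mn] := norm_in_base m.
  exists n; move: hab; rewrite mn scale_b.
  have Nn : norms K n by apply/normsP; exists m.
  have [->|->] := alg_endo_quadratic h1 hM.
    by move=> /quadratic_coord_inj[-> ->]; split=> //; left.
  rewrite sigma_a => /quadratic_coord_inj[-> yE]; split=> //; right.
  by rewrite -yE opprK.
case: yE => yE.
  apply: (@naquat_iso_of_alg_iso _ _ _ _ _ _ _ m idfun) => //; first by exists id.
  by rewrite mn scale_b -xE -yE.
apply: (@naquat_iso_of_alg_iso _ _ _ _ _ _ _ m sigma) => //.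
- by exists (sigma^-1)%g => v /=; rewrite -galM ?memvf // ?mulgV ?mulVg gal_id.
- exact: rmorph1.
- exact: rmorphM.
by rewrite /= mn scale_b -xE sigma_a yE opprK.
Qed.

(** The identification of L with K is compatible with tau and sigma: tau
    sends the square root h(w) of c to itself or its opposite, and the first
    is excluded as tau would then be trivial. So the structure constant b can
    be transported to K. *)
Lemma naquat_with_left_nucleus (A : naAlg F) :
    is_naquat A -> has_left_nucleus K A ->
  exists2 a, a \notin 1%VS & na_iso A (naquat sigma a).
Proof.
move=> [L [tau [b [[dimL galL] tau_gal tau1 bF [g [g_bij g1 gM]]]]]].
move=> [f [f_inj f1 fM f_range]].
have tb : tau b != b by rewrite gal_quadratic_fixed.
have [h [h_bij h1 hM _]] :=
  alg_iso_of_left_nucleus tb f_inj f1 fM f_range g_bij g1 gM.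
have [h' hK h'K] := h_bij.
have halg x : h x%:A = x%:A by rewrite linearZ /= h1.
have tau_alg x : tau x%:A = x%:A by rewrite linearZ rmorph1.
have tau_h v : h (sigma v) = tau (h v).
  have : tau (h w) ^+ 2 == h w ^+ 2.
    by rewrite -rmorphXn /= expr2 -hM -expr2 w_sq halg tau_alg.
  rewrite eqf_sqr => /orP[] /eqP tw.
    case/eqP: tb; rewrite -(h'K b); have [x [y ->]] := quadratic_coord (h' b).
    by rewrite linearD /= rmorphD /= hM rmorphM /= !halg !tau_alg tw.
  have [x [y ->]] := quadratic_coord v.
  rewrite !(rmorphD, rmorphM) /= !sigma_alg sigma_sqrt !linearD /= !hM.
  by rewrite linearN rmorphM /= !halg !tau_alg tw.
exists (h' b).
  rewrite -sigma_fixed; apply: contraNneq tb => shb.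
  by rewrite -(h'K b) -tau_h shb.
apply: (@na_iso_trans _ _ (naquat tau b)); first by exists g.
apply: na_iso_sym.
apply: (@naquat_iso_of_alg_iso _ _ _ _ _ _ _ 1 h) => //; first exact: oner_neq0.
by rewrite rmorph1 !mul1r h'K.
Qed.

(** The two parts of the set of representatives correspond to x = 0 and
    x != 0 for a = x + y w. These are never isomorphic, as an isomorphism
    multiplies x by a nonzero norm. *)
Lemma reps_set_classifies (R C P : set F) :
    coset_reps (norms_pm1 K) R -> coset_reps (norms K) C ->
    coset_reps (pm1 F) P ->
  classifies_naquat sigma (reps_set w R C P).
Proof.
move=> R_reps C_reps P_reps.
have [[R0 R_repr] [C0 C_repr] [P0 P_repr]] := And3 R_reps C_reps P_reps.
have zeroE y : y%:A * w = 0%:A + y%:A * w by rewrite scale0r add0r.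
split=> [a Sa | A naA nucA].
  have aF : a \notin 1%VS.
    case: Sa => [[r /R0 r0 <-] | [r _ [s /P0 s0 <-]]].
      by rewrite zeroE quadratic_coord_notin.
    by rewrite quadratic_coord_notin.
  split=> //.
    by exists K, sigma, a; split=> //; exact: na_iso_refl.
  have [|f [*]] := @naquat_embedding _ _ sigma a; first by rewrite sigma_fixed.
  by exists f.
have [a aF A_a] := naquat_with_left_nucleus naA nucA.
have A_iso b : na_iso A (naquat sigma b) <-> na_iso (naquat sigma a) (naquat sigma b).
  split; first exact/na_iso_trans/na_iso_sym.
  exact: na_iso_trans.
have [x [y aE]] := quadratic_coord a.
move: aF A_iso; rewrite {}aE quadratic_coord_notin => y0 A_iso.
have [x0 | x_neq0] := eqVneq x 0.
  have [t [[Rt yt] t_uniq]] := R_repr y y0.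
  exists (t%:A * w); split.
    split; first by left; exists t.
    apply/A_iso; rewrite (zeroE t); apply/naquat_quadratic_isoP => //; first exact: R0.
    case: yt => yt; [exists (y / t) | exists (- (y / t))].
      by rewrite x0 mulr0 divfK ?R0 //; split=> //; left.
    by rewrite x0 mulr0 mulNr divfK ?R0 // opprK; split=> //; right.
  move=> b [[[r Rr <-] | [r Cr [s Ps <-]]] /A_iso].
    rewrite (zeroE r) => /(naquat_quadratic_isoP _ _ y0 (R0 _ Rr))[n [Nn _ yE]].
    rewrite (t_uniq r) //; split=> //.
    by case: yE => ->; rewrite ?mulNr mulfK ?R0 //; [left | right; rewrite opprK].
  move=> /(naquat_quadratic_isoP _ _ y0 (P0 _ Ps))[n [Nn /esym/eqP]].
  by rewrite x0 mulf_eq0 (negPf (norms_neq0 Nn)) (negPf (C0 _ Cr)).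
have [t [[Ct Nxt] t_uniq]] := C_repr x x_neq0.
have n0 := norms_neq0 Nxt; set n := x / t in Nxt n0.
have [s [[Ps ys] s_uniq]] := P_repr (y / n) (mulf_neq0 y0 (invr_neq0 n0)).
(* once the norm n is fixed by the choice of t, only the sign of y / n is free *)
have pm1E z : z != 0 -> pm1 F (y / n / z) <-> y = n * z \/ y = - (n * z).
  move=> z0; have nz0 : n * z != 0 by rewrite mulf_neq0.
  rewrite -mulrA -invfM (mulrC n z) (mulrC z n); split=> -[] e.
  - by left; rewrite -(divfK nz0 y) e mul1r.
  - by right; rewrite -(divfK nz0 y) e mulN1r.
  - by left; rewrite e divff.
  - by right; rewrite e mulNr divff.
have xE : x = n * t by rewrite divfK ?C0.
exists (t%:A + s%:A * w); split.
  split; first by right; exists t => //; exists s.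
  apply/A_iso/naquat_quadratic_isoP => //; first exact: P0.
  by exists n; split=> //; apply/(pm1E _ (P0 _ Ps)).
move=> b [[[r Rr <-] | [r Cr [z Pz <-]]] /A_iso].
  rewrite (zeroE r) => /(naquat_quadratic_isoP _ _ y0 (R0 _ Rr))[m [_ xm _]].
  by rewrite xm mulr0 eqxx in x_neq0.
move=> /(naquat_quadratic_isoP _ _ y0 (P0 _ Pz))[m [Nm xm ym]].
have tr : t = r by apply: t_uniq; split=> //; rewrite xm mulfK ?C0.
rewrite -tr (s_uniq z) //; split=> //; apply/(pm1E _ (P0 _ Pz)).
suff -> : n = m by [].
by rewrite /n tr xm mulfK ?C0.
Qed.

End QuadraticExtension.

Theorem theorem4p2 (F : fieldType) (charF : 2%N \notin [pchar F])
    (K : splittingFieldType F)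
    (sepK : separable 1 {:K}) (dimK : \dim {:K} = 2%N)
    (c : F) (c_neq0 : c != 0) (c_nsq : forall x : F, x ^+ 2 != c)
    (w : K) (w_sq : w ^+ 2 = c%:A) (genK : <<1; w>>%VS = {:K}%VS)
    (sigma : gal_of {:K})
    (sigma_gal : sigma \in 'Gal({:K} / 1)%g) (sigma_neq1 : sigma != 1%g)
    (CK : set F) (CK_reps : coset_reps (norms K) CK)
    (Fpm : set F) (Fpm_reps : coset_reps (pm1 F) Fpm) :
  (norms K (-1) -> classifies_naquat sigma (reps_set w CK CK Fpm)) /\
  (~ norms K (-1) ->
     forall CKpm : set F, coset_reps (norms_pm1 K) CKpm ->
       classifies_naquat sigma (reps_set w CKpm CK Fpm)).
Proof.
have galK : galois 1 {:K} by rewrite /galois sub1v sepK normalFieldf.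
split=> [N1 | _ R R_reps].
  have normsE : norms_pm1 K = norms K.
    apply/seteqP; split=> [r [//|Nr] | r]; last by left.
    rewrite -[r]opprK -mulN1r.
    exact: (normsM galK dimK sigma_gal sigma_neq1).
  by apply: reps_set_classifies => //; rewrite normsE.
exact: reps_set_classifies.
Qed.
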